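(* In the game $\mathrm{CubeGame}(p,K)$ with expert oracle (defined in the context), any sound planner that makes fewer than $\Omega(p/\log p)$ oracle queries has sample complexity (expected number of actions) $N\ge 2^{\Omega(p\wedge K)}$.
   Context: Fix integers $p,K\ge1$ (with $p$ divisible by $4$). Let $W=\{\pm1\}^p$, $\rho(x,y)=\tfrac12(p-x^\top y)$ the Hamming distance, $w_0=\vec 1$ (all-ones vector), and $g(x)=1-x/p$. The hidden parameter $w^\star$ lies in $W^\star=\{w\in W:\ p/4\le\rho(\vec1,w)\le 3p/4\}$. For $k\ge1$, $W^{\circ k}=\{(w_i)_{i\in[k]}\in W^k:\ \rho(w_{i-1},w_i)\ge p/4\ \forall i\in[k]\}$. Define $f_{w^\star}((w_i)_{i\in[k]})=\big(\prod_{i\in[k]}g(\rho(w_{i-1},w_i))\big)\,g(\rho(w_k,w^\star))$ and $f_{w^\star}(())=g(\rho(w_0,w^\star))$. At each round $t$ the planner either inputs a sequence $S_t=(w^t_i)_{i\in[L_t]}\in W^{\circ L_t}$ with $L_t\in[K]$, or stops ($L_t=0$) and outputs $S_t=(w^t_i)_{i\in[8]}\in W^{\circ 8}$; $N=\min\{t:L_t=0\}$ is the number of actions. After an input it observes $U_t=\mathbb{1}\{\rho(w^t_{L_t-1},w^\star)<p/4\}$, $V_t=\mathbb{1}\{\rho(w^t_{L_t},w^\star)<p/4\}$ and $Z_t$, where $Z_t=0$ unless $V_t=1$ or $L_t=K$, in which case $Z_t\sim\mathrm{Ber}(f_{w^\star}(S_t))$. When the planner stops, it receives final reward $R=f_{w^\star}((w^N_i)_{i\in[k^\star]})$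 with $k^\star=\min\{8,\min\{k:\rho(w^N_k,w^\star)<p/4\}\}$. Expert oracle: partway through inputting a sequence (after a prefix whose last vector is $w$), the planner may query the oracle, which returns the index of the first coordinate where $w$ and $w^\star$ differ, or a special symbol if $w=w^\star$; it may then continue the sequence, as long as the total length stays at most $K$. A planner is sound if for every $w^\star\in W^\star$ its expected final reward $\mathbb{E}[R]$ is within $0.01$ of the maximal achievable final reward (which is at least $f_{w^\star}(())$). *)

(* Defs.v *)
From HB Require Import structures.
From mathcomp Require Import all_boot all_order all_algebra.
From mathcomp Require Import all_classical all_reals all_analysis.
Set Implicit Arguments. Unset Strict Implicit. Unset Printing Implicit Defensive.
Import Order.TTheory GRing.Theory Num.Theory.
Local Open Scope ring_scope.

(* W = {+-1}^p is represented by boolean vectors (true = +1, false = -1).    *)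

Section Cube.
Variable p : nat.

Definition W := {ffun 'I_p -> bool}.

(* Hamming distance rho(x,y) = (p - x^T y)/2 = #{i | x_i <> y_i}. *)
Definition rho (x y : W) : nat := #|[set i | x i != y i]|.

Definition w0 : W := [ffun => true].

Definition Wstar (w : W) : bool := (p <= 4 * rho w0 w)%N && (4 * rho w0 w <= 3 * p)%N.

Definition close (x y : W) : bool := (4 * rho x y < p)%N.

Fixpoint circ_from (prev : W) (s : seq W) : bool :=
  if s is w :: s' then (p <= 4 * rho prev w)%N && circ_from w s' else true.
Definition circ (s : seq W) : bool := circ_from w0 s.

Variable R : realType.

Definition g (x : nat) : R := 1 - x%:R / p%:R.

Definition fval (ws : W) (s : seq W) : R :=
  (\prod_(i < size s) g (rho (nth w0 (w0 :: s) i) (nth w0 s i)))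
  * g (rho (last w0 s) ws).

(* final reward for an output sequence (w_i)_{i in [8]} :                     *)
(* k* = min{8, min{k : rho(w_k,w^star) < p/4}} (min of the empty set = infinity) *)
Definition kstar (ws : W) (s : seq W) : nat :=
  minn 8 (find (fun w => close w ws) s).+1.
Definition reward (ws : W) (s : seq W) : R := fval ws (take (kstar ws s) s).

Definition max_reward (ws : W) : R :=
  \big[Num.max/0]_(s : 8.-tuple W | circ s) reward ws s.

Definition oracle (w ws : W) : option 'I_p :=
  [pick i : 'I_p | (w i != ws i) && [forall j : 'I_p, (j < i)%N ==> (w j == ws j)]].

(* Events of an interaction.  A round in which a sequence is input consists *)
(* of Append events (one vector at a time), interleaved oracle Query events *)
(* (each immediately followed by the oracle's Answer), then Submit, which   *)
(* is immediately followed by the observation Obs U V Z.  A stopping round  *)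
(* is a single Stop event carrying the output sequence.                     *)
Inductive Event :=
  | EStop of 8.-tuple W
  | EAppend of W
  | EQuery
  | EAnswer of option 'I_p
  | ESubmit
  | EObs of bool & bool & bool.

Definition enc (e : Event) :
  (8.-tuple W + (W + (option (option 'I_p) + option (bool * bool * bool))))%type :=
  match e with
  | EStop s => inl s
  | EAppend w => inr (inl w)
  | EQuery => inr (inr (inl None))
  | EAnswer a => inr (inr (inl (Some a)))
  | ESubmit => inr (inr (inr None))
  | EObs u v z => inr (inr (inr (Some (u, v, z))))
  end.
Definition dec
  (x : (8.-tuple W + (W + (option (option 'I_p) + option (bool * bool * bool))))%type)
  : Event :=
  match x with
  | inl s => EStop s
  | inr (inl w) => EAppend w
  | inr (inr (inl None)) => EQuery
  | inr (inr (inl (Some a))) => EAnswer a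
  | inr (inr (inr None)) => ESubmit
  | inr (inr (inr (Some (u, v, z)))) => EObs u v z
  end.
Lemma encK : cancel enc dec. Proof. by case. Qed.

HB.instance Definition _ := Equality.copy Event (can_type encK).
HB.instance Definition _ := Choice.copy Event (can_type encK).
HB.instance Definition _ := Countable.copy Event (can_type encK).
HB.instance Definition _ := Finite.copy Event (can_type encK).

Definition cur_step (s : seq W) (e : Event) : seq W :=
  match e with
  | EAppend w => rcons s w
  | EObs _ _ _ => [::]
  | _ => s
  end.
Definition cur_prefix (h : seq Event) : seq W := foldl cur_step [::] h.

Definition legal (K : nat) (s : seq W) (e : Event) : bool :=
  match e with
  | EStop t => (s == [::]) && circ t
  | EAppend w => (size s < K)%N && (p <= 4 * rho (last w0 s) w)%N
  | EQuery => s != [::]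
  | ESubmit => s != [::]
  | _ => false
  end.

Definition planner := seq Event -> Event -> R.

Definition valid_planner (K : nat) (pi : planner) : Prop :=
  forall h : seq Event,
    (forall e, 0 <= pi h e) /\ (\sum_(e : Event) pi h e = 1) /\
    (forall e, 0 < pi h e -> legal K (cur_prefix h) e).

Definition step_prob (K : nat) (pi : planner) (ws : W) (past : seq Event) (e : Event) : R :=
  let s := cur_prefix past in
  match last EQuery (EObs false false false :: past) with
  | EQuery =>
      if e == EAnswer (oracle (last w0 s) ws) then 1 else 0
  | ESubmit =>
      match e with
      | EObs u v z =>
          let L := size s in
          let Ut := close (last w0 (take L.-1 s)) ws in
          let Vt := close (last w0 s) ws in
          if (u == Ut) && (v == Vt) then
            (if Vt || (L == K) then (if z then fval ws s else 1 - fval ws s)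
             else (if z then 0 else 1))
          else 0
      | _ => 0
      end
  | EStop _ => 0
  | _ => match e with
         | EAnswer _ | EObs _ _ _ => 0
         | _ => pi past e
         end
  end.

Fixpoint run_prob_from (K : nat) (pi : planner) (ws : W) (past h : seq Event) : R :=
  if h is e :: h' then step_prob K pi ws past e * run_prob_from K pi ws (rcons past e) h'
  else 1.

Definition run_prob K pi ws (h : seq Event) : R := run_prob_from K pi ws [::] h.

Definition is_stop (e : Event) : bool := if e is EStop _ then true else false.

Definition complete (h : seq Event) : bool := is_stop (last ESubmit h).

(* N = number of actions = number of inputs + the final stopping round *)
Definition num_actions (h : seq Event) : nat := (count_mem ESubmit h).+1.

Definition num_queries (h : seq Event) : nat := count_mem EQuery h.

Definition final_output (h : seq Event) : seq W :=
  if last ESubmit h is EStop s then s else [::].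

Local Open Scope ereal_scope.

Definition prob_N_le K pi ws (t : nat) : \bar R :=
  \sum_(0 <= n <oo)
    (\sum_(h : n.-tuple Event | complete h && (num_actions h <= t)%N)
        run_prob K pi ws h)%:E.

(* E[N] = sum_{t >= 0} P(N > t)   (= +oo if the planner fails to stop a.s.) *)
Definition expected_N K pi ws : \bar R :=
  \sum_(0 <= t <oo) (1 - prob_N_le K pi ws t).

(* E[R] (runs that never stop contribute reward 0) *)
Definition expected_reward K pi ws : \bar R :=
  \sum_(0 <= n <oo)
    (\sum_(h : n.-tuple Event | complete h)
        run_prob K pi ws h * reward ws (final_output h))%:E.

Local Close Scope ereal_scope.

Definition sound (K : nat) (pi : planner) : Prop :=
  forall ws : W, Wstar ws ->
    ((max_reward ws - 1/100)%:E <= expected_reward K pi ws <= (max_reward ws + 1/100)%:E)%E.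

Definition query_bounded (K : nat) (pi : planner) (Q : R) : Prop :=
  forall ws : W, Wstar ws -> forall h : seq Event,
    0 < run_prob K pi ws h -> (num_queries h)%:R < Q.

End Cube.

(* Main.v *)
Require Import Defs.
From HB Require Import structures.
From mathcomp Require Import all_boot all_order all_algebra.
From mathcomp Require Import all_classical all_reals all_analysis.
From mathcomp Require Import lra zify ring.

(** The best reward is at least 1/4, whereas an output none of whose vectors is
    within p/4 of w* earns at most (3/4)^8 < 0.11; so a sound planner must find
    such a vector with constant probability.  As long as no submitted vector is
    close to w*, an input returns U = V = 0, and Z = 1 with probability at most
    (3/4)^K; hence the only information about w* comes from the oracle, and m
    queries distinguish at most (p+1)^m cases.  In each case r inputs and one
    output test at most 2r + 8 vectors, each close to a uniform w* with
    probability at most (16/27)^(p/4).  A union bound thus shows that, with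
    b = 21/20, runs with at most b^(min(p,K))/100 inputs rarely succeed on average
    over w*, so that for some w* more are made with probability at least 1/10.
    Bernoulli's inequality turns this into E[N] >= b^(min(p,K)/1000), which also
    covers small K. *)

Set Implicit Arguments.
Unset Strict Implicit.
Unset Printing Implicit Defensive.
Import Order.TTheory GRing.Theory Num.Theory.
Local Open Scope ring_scope.

(** * Ball volumes in the cube and bounds on rewards *)

Section Cube.
Variables (p : nat) (R : realType).

(** Antipodes turn distance above 3p/4 into distance below p/4, and provide a legal move from any
    vector. *)
Definition antipode (w : W p) : W p := [ffun i => ~~ w i].

Lemma rho_le (x y : W p) : (rho x y <= p)%N.
Proof. by rewrite /rho -[leqRHS](card_ord p) max_card. Qed.

Lemma rho_refl (x : W p) : rho x x = 0%N.
Proof. by apply/eqP; rewrite cards_eq0; apply/eqP/setP => i; rewrite !inE eqxx. Qed.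

Lemma rho_antipode (x y : W p) : (rho (antipode x) y + rho x y)%N = p.
Proof.
rewrite /rho -[RHS](card_ord p) -(cardsC [set i | antipode x i != y i]).
congr (_ + _)%N; apply: eq_card => i; rewrite !inE ffunE.
by case: (x i) (y i) => [] [].
Qed.

Lemma antipode_far (x : W p) : (p <= 4 * rho x (antipode x))%N.
Proof.
have := rho_antipode (antipode x) (antipode x); rewrite rho_refl addn0.
have -> : antipode (antipode x) = x by apply/ffunP => i; rewrite !ffunE negbK.
by move=> ->; lia.
Qed.

Definition nearby (w : W p) : {set W p} := [set ws | Defs.close w ws].

(** The sum factors over the coordinates, each of which contributes [1 + x]: one value agrees with
    [w], the other does not. *)
Lemma sum_expr_rho (x : R) (w : W p) :
  \sum_(ws : W p) x ^+ rho w ws = (1 + x) ^+ p.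
Proof.
transitivity (\sum_(ws : W p) \prod_(i < p) x ^+ (w i != ws i)).
  apply: eq_bigr => ws _; rewrite /rho -sum1dep_card expr_sum big_mkcond /=.
  by apply: eq_bigr => i _; case: (w i != ws i); rewrite ?expr0 ?expr1.
rewrite -(bigA_distr_bigA (fun i (b : bool) => x ^+ (w i != b))) /=.
rewrite -[in RHS](card_ord p) -prodr_const; apply: eq_bigr => i _.
by rewrite big_bool /=; case: (w i); rewrite /= ?expr0 ?expr1 // addrC.
Qed.

(* Chernoff bound: [3^-rho] has mean [(2/3)^p], and is at least [3^-(p/4)]
   on the ball. *)
Lemma card_nearby (n : nat) (w : W p) : p = (4 * n)%N ->
  (#|nearby w|%:R : R) <= 2 ^+ p * (16 / 27) ^+ n.
Proof.
move=> pE; have x0 : 0 < (3^-1 : R) by rewrite invr_gt0 ltr0n.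
have le1 : (#|nearby w|%:R : R) * 3^-1 ^+ n <= (1 + 3^-1) ^+ p.
  rewrite -(sum_expr_rho _ w) mulr_natl -sumr_const.
  rewrite [leLHS]big_mkcond /=; apply: ler_sum => ws _.
  case: ifP => [|_]; last by rewrite exprn_ge0 // ltW.
  rewrite inE /Defs.close => lt_rho.
  apply: ler_wiXn2l; [exact: ltW | by rewrite invf_le1 ?ltr0n ?ler1n | lia].
(* Both sides become [n]-th powers of 256/81 = (4/3)^4 = 2^4 (16/27) / 3. *)
rewrite -(ler_pM2r (exprn_gt0 n x0)) (le_trans le1) // pE !exprM -!exprMn.
apply: lerXn2r; rewrite ?nnegrE; lra.
Qed.

(** The complement of [Wstar] is covered by the open quarter balls around [w0] and its antipode;
    from [n = 3] on, each holds at most a quarter of the cube. *)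
Lemma card_Wstar (n : nat) : p = (4 * n)%N -> (3 <= n)%N ->
  2 ^+ p / 2 <= (#|[set ws : W p | Wstar ws]|%:R : R).
Proof.
move=> pE n3; set A := [set ws : W p | Wstar ws].
have cW : (#|A| + #|~: A| = 2 ^ p)%N.
  by rewrite cardsC card_ffun card_bool card_ord.
have le1 : (#|~: A| <= #|nearby (w0 p)| + #|nearby (antipode (w0 p))|)%N.
  apply: leq_trans (leq_card_setU _ _); apply/subset_leq_card/fintype.subsetP => ws.
  rewrite !inE /Wstar /Defs.close => /nandP far.
  have := rho_antipode (w0 p) ws; case: far; rewrite -ltnNge => far eqp; apply/orP.
  - by left.
  - by right; lia.
have le2 : ((16 / 27) ^+ n : R) <= 1 / 4.
  apply: le_trans (_ : (16 / 27) ^+ 3 <= _); last lra.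
  by apply: ler_wiXn2l => //; lra.
have := card_nearby (w0 p) pE; have := card_nearby (antipode (w0 p)) pE.
move: le1; rewrite -(ler_nat R) natrD; move/(congr1 (fun k => k%:R : R)): cW.
rewrite natrD natrX.
have : 0 < (2 ^+ p : R) by rewrite exprn_gt0 // ltr0n.
move: (2 ^+ p : R) => N; move: ((16 / 27) ^+ n) le2 => y le2 N0 e1 e2 e3 e4.
nra.
Qed.

Lemma g_ge0 (x y : W p) : 0 <= g p R (rho x y).
Proof.
(* For [p = 0] division by zero returns 0, so [g] is 1. *)
rewrite /g subr_ge0; have [p0|p0] := posnP p.
  by have -> : (p%:R : R) = 0; rewrite ?p0 ?invr0 ?mulr0.
by rewrite ler_pdivrMr ?ltr0n // mul1r ler_nat rho_le.
Qed.

Lemma g_le1 (k : nat) : g p R k <= 1.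
Proof. by rewrite /g gerBl divr_ge0. Qed.

Lemma g_far (k : nat) : (0 < p)%N -> (p <= 4 * k)%N -> g p R k <= 3 / 4.
Proof.
move=> p0 far; rewrite /g.
suff : 1 / 4 <= (k%:R / p%:R : R) by lra.
rewrite ler_pdivlMr ?ltr0n //; move: far; rewrite -(ler_nat R) natrM; lra.
Qed.

Lemma fval_ge0 (ws : W p) s : 0 <= fval R ws s.
Proof. by rewrite mulr_ge0 ?g_ge0 // prodr_ge0 // => i _; exact: g_ge0. Qed.

Lemma fval_le1 (ws : W p) s : fval R ws s <= 1.
Proof.
rewrite -[1]mulr1 ler_pM ?g_ge0 ?g_le1 //.
  by rewrite prodr_ge0 // => i _; exact: g_ge0.
by apply: prodr_ile1 => i _; rewrite g_ge0 g_le1.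
Qed.

Lemma circ_from_rcons (w : W p) s x :
  circ_from w (rcons s x) = circ_from w s && (p <= 4 * rho (last w s) x)%N.
Proof.
by elim: s w => [|y s IHs] w /=; rewrite ?andbT // IHs andbA.
Qed.

Lemma circ_from_nth (w : W p) s i : circ_from w s -> (i < size s)%N ->
  (p <= 4 * rho (nth (w0 p) (w :: s) i) (nth (w0 p) s i))%N.
Proof.
by elim: s w i => [|y s IHs] w [|i] //= /andP[far]; last exact: IHs.
Qed.

Lemma fval_circ (ws : W p) s : (0 < p)%N -> circ s ->
  fval R ws s <= (3 / 4) ^+ size s.
Proof.
move=> p0 cs; rewrite -[leRHS]mulr1 ler_pM ?g_ge0 ?g_le1 //.
  by rewrite prodr_ge0 // => i _; exact: g_ge0.
rewrite -[in leRHS](card_ord (size s)) -prodr_const.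
apply: ler_prod => i _; rewrite g_ge0 /=; apply: g_far => //.
exact: circ_from_nth cs (ltn_ord i).
Qed.

Definition hit (ws : W p) (s : seq (W p)) : bool := has (fun w => Defs.close w ws) s.

Lemma reward_ge0 (ws : W p) s : 0 <= reward R ws s.
Proof. exact: fval_ge0. Qed.

(** Without a hit [kstar] is 8, so eight factors of at most 3/4 remain; with a hit the trivial bound
    1 is used. *)
Lemma reward_le_hit (ws : W p) (s : 8.-tuple (W p)) : (0 < p)%N -> circ s ->
  reward R ws s <= (3 / 4) ^+ 8 + (hit ws s)%:R.
Proof.
move=> p0 cs; have [h|nh] := boolP (hit ws s).
  by rewrite (le_trans (fval_le1 _ _)) //= lerDr exprn_ge0 // divr_ge0.
rewrite addr0 /reward /kstar hasNfind // size_tuple /= take_oversize ?size_tuple //.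
by have := fval_circ ws p0 cs; rewrite size_tuple.
Qed.

Lemma max_reward_ge (ws : W p) : (0 < p)%N -> Wstar ws ->
  1 / 4 <= max_reward R ws.
Proof.
move=> p0 /andP[far near]; pose v := antipode ws.
have vw : (p <= 4 * rho v ws)%N.
  by have := rho_antipode ws ws; rewrite -/v rho_refl; lia.
(* Moving straight to [ws] gives [kstar = 1]; alternating with the antipode fills the other places
   legally. *)
pose s : 8.-tuple (W p) := [tuple ws; v; ws; v; ws; v; ws; v].
have cs : circ s by rewrite /circ /= far vw antipode_far.
pose F (t : 8.-tuple (W p)) := reward R ws t.
pose P (t : 8.-tuple (W p)) := circ t.
apply: le_trans (@le_bigmax_cond _ _ _ 0 s P F cs).
rewrite /F /reward (_ : kstar ws s = 1%N); last first.
  by rewrite /kstar /= /Defs.close rho_refl muln0 p0.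
rewrite /fval /= big_ord1 /= rho_refl {2}/g mul0r subr0 mulr1 /g.
suff : ((rho (w0 p) ws)%:R / p%:R : R) <= 3 / 4 by lra.
by rewrite ler_pdivrMr ?ltr0n //; move: near; rewrite -(ler_nat R) !natrM; lra.
Qed.
End Cube.

(** * Runs of a planner: transition probabilities and truncated means *)

Lemma big_tuple_cons (T : finType) (R : nmodType) n (P : seq T -> bool)
    (F : seq T -> R) :
  \sum_(h : n.+1.-tuple T | P h) F h =
  \sum_(e : T) \sum_(h : n.-tuple T | P (e :: h)) F (e :: h).
Proof.
rewrite pair_big_dep /=.
rewrite (reindex (fun eh : T * n.-tuple T => [tuple of eh.1 :: eh.2])) //=.
exists (fun t : n.+1.-tuple T => (thead t, [tuple of behead t])).
  by move=> [e h] _ /=; rewrite theadE; congr pair; apply: val_inj.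
by move=> t _; rewrite -tuple_eta.
Qed.

Section Process.
Variables (p : nat) (R : realType) (K : nat) (pi : planner p R).
Hypothesis pi_valid : valid_planner K pi.

Local Notation Event := (Event p).
Local Notation start := (EObs p false false false).
Local Notation step := (step_prob K pi).
Local Notation run := (run_prob K pi).

(** The default events for an empty history differ, but neither is a stop; with [start] as default
    the planner moves first. *)
Lemma complete_last (h : seq Event) : complete h = is_stop (last start h).
Proof. by case: h. Qed.

Definition planner_turn (e : Event) : bool :=
  match e with EStop _ | EQuery | ESubmit => false | _ => true end.

Lemma step_stop ws h t e : last start h = EStop t -> step ws h e = 0.
Proof. by rewrite /step_prob /= => ->. Qed.

Lemma step_query ws h e : last start h = EQuery p ->
  step ws h e = (e == EAnswer (oracle (last (w0 p) (cur_prefix h)) ws))%:R.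
Proof. by rewrite /step_prob /= => ->; case: eqP. Qed.

(** [step_prob] cuts out answers and observations here, but these are illegal, so a valid planner
    gives them probability 0 anyway. *)
Lemma step_planner ws h e : planner_turn (last start h) -> step ws h e = pi h e.
Proof.
have pi0 : ~~ legal K (cur_prefix h) e -> 0 = pi h e.
  have [ge0 [_ leg]] := pi_valid h; move=> nleg; apply/eqP.
  by rewrite eq_le ge0 /= leNgt; apply: contra nleg => /leg.
rewrite /step_prob /=; case: (last start h) => //= *; case: e pi0 => //=; auto.
Qed.

Definition submit_prob (ws : W p) (s : seq (W p)) (z : bool) : R :=
  if Defs.close (last (w0 p) s) ws || (size s == K)
  then (if z then fval R ws s else 1 - fval R ws s) else (~~ z)%:R.

Lemma submit_prob_ge0 ws s z : 0 <= submit_prob ws s z.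
Proof.
rewrite /submit_prob; case: ifP => // _.
by case: z; rewrite ?subr_ge0 ?fval_le1 ?fval_ge0.
Qed.

Lemma submit_probD ws s : submit_prob ws s true + submit_prob ws s false = 1.
Proof. by rewrite /submit_prob; case: ifP => _ /=; rewrite ?subrKC ?add0r. Qed.

(** U and V are determined by [ws], so the law is a sum of two point masses, one per value of Z;
    expectations then follow from [sum_indicator]. *)
Lemma step_submit ws h e : last start h = ESubmit p ->
  let s := cur_prefix h in
  let u := Defs.close (last (w0 p) (take (size s).-1 s)) ws in
  let v := Defs.close (last (w0 p) s) ws in
  step ws h e = (e == EObs p u v true)%:R * submit_prob ws s true
              + (e == EObs p u v false)%:R * submit_prob ws s false.
Proof.
rewrite /step_prob /= => ->.
case: e => [?|?||?||a b z]; try by do 2![case: eqP => // _]; rewrite !mul0r addr0.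
have eqE u v y : (EObs p a b z == EObs p u v y) = [&& a == u, b == v & z == y].
  apply/eqP/and3P => [[-> -> ->]|[/eqP-> /eqP-> /eqP->]] //.
rewrite !{}eqE /submit_prob; case: eqP => _ //=; last by rewrite ?mul0r ?addr0.
case: eqP => _ //=; last by rewrite ?mul0r ?addr0.
by case: z; case: ifP => _ /=; rewrite ?mul1r ?mul0r ?addr0 ?add0r.
Qed.

Lemma sum_indicator (I : finType) (i : I) (F : I -> R) :
  \sum_j (j == i)%:R * F j = F i.
Proof.
rewrite (bigD1 i) //= eqxx mul1r big1 ?addr0 // => j /negbTE ->.
by rewrite mul0r.
Qed.

Lemma sum_step_query ws h F : last start h = EQuery p ->
  \sum_e step ws h e * F e = F (EAnswer (oracle (last (w0 p) (cur_prefix h)) ws)).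
Proof.
by move=> hE; under eq_bigr do rewrite step_query //; rewrite sum_indicator.
Qed.

Lemma sum_step_submit ws h F : last start h = ESubmit p ->
  let s := cur_prefix h in
  let u := Defs.close (last (w0 p) (take (size s).-1 s)) ws in
  let v := Defs.close (last (w0 p) s) ws in
  \sum_e step ws h e * F e = submit_prob ws s true * F (EObs p u v true)
                           + submit_prob ws s false * F (EObs p u v false).
Proof.
move=> hE s u v; under eq_bigr do rewrite step_submit // mulrDl -!mulrA.
by rewrite big_split /= !sum_indicator.
Qed.

(** The total is 1 except after a stop, where it is 0. *)
Lemma sum_step_le1 ws h : \sum_e step ws h e <= 1.
Proof.
have [pt|] := boolP (planner_turn (last start h)).
  have [_ [<- _]] := pi_valid h.
  by apply: ler_sum => e _; rewrite step_planner.
under eq_bigr do rewrite -[step _ _ _]mulr1.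
case hE: (last start h) => [t|?||?||? ? ?] // _.
- by rewrite big1 // => e _; rewrite (step_stop _ _ hE) mul0r.
- by rewrite sum_step_query.
- by rewrite sum_step_submit //= !mulr1 submit_probD.
Qed.

Lemma step_ge0 ws h e : 0 <= step ws h e.
Proof.
have [pt|] := boolP (planner_turn (last start h)).
  by rewrite step_planner //; have [] := pi_valid h.
case hE: (last start h) => [t|?||?||? ? ?] // _.
- by rewrite (step_stop _ _ hE).
- by rewrite step_query.
- by rewrite step_submit //= addr_ge0 ?mulr_ge0 ?submit_prob_ge0.
Qed.

Lemma run_from_ge0 ws past h : 0 <= run_prob_from K pi ws past h.
Proof. by elim: h past => //= e h IHh past; rewrite mulr_ge0 ?step_ge0. Qed.

Lemma run_rcons ws h e : run ws (rcons h e) = run ws h * step ws h e.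
Proof.
rewrite /run_prob; rewrite -[in step _ h _](cat0s h); move: [::].
elim: h => [|x h IHh] past /=; first by rewrite mul1r mulr1 cats0.
by rewrite IHh mulrA cat_rcons.
Qed.

Lemma run_rcons_gt0 ws h e :
  (0 < run ws (rcons h e)) = (0 < run ws h) && (0 < step ws h e).
Proof.
rewrite run_rcons !lt0r mulf_eq0 negb_or mulr_ge0 ?step_ge0 ?run_from_ge0 //.
by rewrite andbT !andbT.
Qed.

Lemma step_gt0_legal ws h e : 0 < step ws h e ->
  match e with EAnswer _ | EObs _ _ _ => true | _ => legal K (cur_prefix h) e end.
Proof.
have [pt|] := boolP (planner_turn (last start h)).
  rewrite step_planner //; have [_ [_ leg]] := pi_valid h.
  by move=> /leg; case: e.
case hE: (last start h) => [t|?||?||? ? ?] // _.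
- by rewrite (step_stop _ _ hE) ltxx.
- by rewrite step_query // ltr0n lt0b => /eqP->.
- rewrite step_submit //=; case: eqP => [-> //|_]; case: eqP => [-> //|_].
  by rewrite !mul0r addr0 ltxx.
Qed.

Lemma circ_cur_prefix ws h : 0 < run ws h -> circ (cur_prefix h).
Proof.
elim/last_ind: h => [|h e IHh] //; rewrite run_rcons_gt0 => /andP[/IHh ch].
move=> /step_gt0_legal; rewrite /cur_prefix foldl_rcons -/(cur_prefix h).
case: e => //= w /andP[_ far].
by rewrite /circ circ_from_rcons -/(circ _) ch.
Qed.

Lemma circ_final_output ws h : 0 < run ws h -> complete h ->
  exists2 t : 8.-tuple (W p), final_output h = t & circ t.
Proof.
case/lastP: h => // h e; rewrite run_rcons_gt0 => /andP[_ /step_gt0_legal].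
rewrite /complete /final_output last_rcons; case: e => //= t /andP[_ ct] _.
by exists t.
Qed.

(* The mean of [F] over the runs extending [past] by fewer than [M] events;
   runs that have not stopped by then count as 0. *)
Fixpoint stop_mean (ws : W p) (F : seq Event -> R) (M : nat) (past : seq Event) : R :=
  if M is M'.+1 then
    (complete past)%:R * F past
    + \sum_e step ws past e * stop_mean ws F M' (rcons past e)
  else 0.

(** Links the recursion to the partial sums of the series that define [prob_N_le] and
    [expected_reward]. *)
Lemma stop_meanE ws F M past : stop_mean ws F M past =
  \sum_(0 <= n < M) \sum_(h : n.-tuple Event | complete (past ++ h))
    run_prob_from K pi ws past h * F (past ++ h).
Proof.
elim: M past => [|M IHM] past /=; first by rewrite big_nil.
rewrite big_nat_recl //; congr (_ + _).
  rewrite big_mkcond (big_pred1 [tuple]) /=; last first.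
    by move=> t; apply/esym/eqP; exact: tuple0.
  by rewrite cats0; case: complete; rewrite ?mul1r ?mul0r.
under [RHS]eq_bigr do rewrite (big_tuple_cons _ (fun h => complete (past ++ h))
  (fun h => run_prob_from K pi ws past h * F (past ++ h))).
rewrite exchange_big /=; apply: eq_bigr => e _; rewrite IHM mulr_sumr.
apply: eq_bigr => n _; rewrite mulr_sumr.
by apply: eq_big => h; rewrite cat_rcons // mulrA.
Qed.

Lemma stop_mean_lin ws a F G M past :
  stop_mean ws (fun h => a * F h + G h) M past =
  a * stop_mean ws F M past + stop_mean ws G M past.
Proof.
elim: M past => [|M IHM] past /=; first by rewrite mulr0 addr0.
under eq_bigr do rewrite IHM mulrDr mulrCA.
by rewrite big_split /= -mulr_sumr; ring.
Qed.

Lemma ler_stop_mean ws F G M :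
  (forall h, complete h -> 0 < run ws h -> F h <= G h) ->
  stop_mean ws F M [::] <= stop_mean ws G M [::].
Proof.
move=> leFG; rewrite !stop_meanE; apply: ler_sum => n _; apply: ler_sum => h ch.
have := run_from_ge0 ws [::] h; rewrite le0r => /orP[/eqP-> | h0].
  by rewrite !mul0r.
by rewrite ler_pM2l // leFG.
Qed.

Lemma stop_mean_ge0 ws F M past : (forall h, 0 <= F h) -> 0 <= stop_mean ws F M past.
Proof.
move=> F0; elim: M past => [|M IHM] past //=.
by rewrite addr_ge0 ?mulr_ge0 // sumr_ge0 // => e _; rewrite mulr_ge0 ?step_ge0.
Qed.

Lemma stop_mean_le1 ws F M past : (forall h, F h <= 1) -> stop_mean ws F M past <= 1.
Proof.
move=> F1; elim: M past => [|M IHM] past //=.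
(* After a stop the sum over next events vanishes, and otherwise the first summand does, so the two
   never add up. *)
rewrite complete_last; case hE: (last start past) => [t|?||?||? ? ?] /=.
  rewrite mul1r big1 ?addr0 // => e _.
  by rewrite (step_stop _ _ hE) mul0r.
all: rewrite mul0r add0r; apply: le_trans (sum_step_le1 ws past).
all: by apply: ler_sum => e _; rewrite ler_piMr ?step_ge0.
Qed.

End Process.

(** * Union bound over the hidden vector, by a potential along the history *)

Section Potential.
Variables (p : nat) (R : realType) (K : nat) (pi : planner p R).
Hypotheses (pi_valid : valid_planner K pi) (p_gt0 : (0 < p)%N) (K_gt0 : (0 < K)%N).
Variables (m T : nat) (D : R).
Hypothesis query_le : forall ws : W p, Wstar ws ->
  forall h, 0 < run_prob K pi ws h -> (num_queries h <= m)%N.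
Hypothesis card_nearby_le : forall w : W p, #|nearby w|%:R <= D.

Local Notation Event := (Event p).
Local Notation start := (EObs p false false false).
Local Notation step := (step_prob K pi).
Local Notation run := (run_prob K pi).
Local Notation mean := (stop_mean K pi).

Lemma submits_rcons h (e : Event) : count_mem (ESubmit p) (rcons h e) =
  (count_mem (ESubmit p) h + (if e is ESubmit then 1 else 0))%N.
Proof.
rewrite -cats1 count_cat /= addn0; congr (_ + _)%N.
by case: eqP => [->|]; case: e.
Qed.

Lemma queries_rcons h (e : Event) : num_queries (rcons h e) =
  (num_queries h + (if e is EQuery then 1 else 0))%N.
Proof.
rewrite /num_queries -cats1 count_cat /= addn0; congr (_ + _)%N.
by case: eqP => [->|]; case: e.
Qed.

Definition found (ws : W p) (h : seq Event) : R :=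
  ((num_actions h <= T)%N && hit ws (final_output h))%:R.

Lemma found_ge0 ws h : 0 <= found ws h. Proof. by rewrite ler0n. Qed.

Lemma found_le1 ws h : found ws h <= 1. Proof. by rewrite lern1; case: andb. Qed.

Lemma D_ge0 : 0 <= D.
Proof. exact: le_trans (ler0n _ _) (card_nearby_le (w0 p)). Qed.

Lemma sum_close_le (A : {set W p}) w :
  \sum_(ws in A) (Defs.close w ws)%:R <= D.
Proof.
apply: le_trans (card_nearby_le w); rewrite -sum1_card natr_sum.
rewrite big_mkcond [leRHS]big_mkcond; apply: ler_sum => ws _.
by rewrite inE; case: (ws \in A); case: Defs.close.
Qed.

Lemma sum_hit_le (A : {set W p}) s :
  \sum_(ws in A) (hit ws s)%:R <= (size s)%:R * D.
Proof.
elim: s => [|w s IHs] /=; first by rewrite big1 ?mul0r.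
rewrite -addn1 natrD mulrDl mul1r addrC.
apply: le_trans (lerD (sum_close_le A w) IHs); rewrite -big_split /=.
apply: ler_sum => ws _; rewrite /hit /=.
by case: Defs.close; rewrite /= ?add0r // lerDl.
Qed.

(** The stopping round is an action too, so [T] inputs already mean more than [T] actions. *)
Lemma stop_mean_late ws M past :
  (T <= count_mem (ESubmit p) past)%N -> mean ws (found ws) M past = 0.
Proof.
elim: M past => [|M IHM] past le_past //=.
rewrite /found /num_actions ltnNge le_past mulr0 add0r big1 // => e _.
by rewrite IHM ?mulr0 // submits_rcons (leq_trans le_past) ?leq_addr.
Qed.

(** With [a] candidates, [r] inputs and [q] queries left: the first term pays for some Z = 1, the
    second for a close vector among two per input (seen by U and V) and eight in the output, once
    for each sequence of answers. *)
Definition bound (a r q : nat) : R :=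
  a%:R * r%:R * (3 / 4) ^+ K + (2 * r + 8)%:R * D * p.+1%:R ^+ q.

Lemma bound_ge0 a r q : 0 <= bound a r q.
Proof.
by rewrite addr_ge0 ?mulr_ge0 ?D_ge0 ?exprn_ge0 ?divr_ge0.
Qed.

Lemma bound_ge_stop a r q : 8 * D <= bound a r q.
Proof.
have e1 : 1 <= p.+1%:R ^+ q :> R by rewrite exprn_ege1 // ler1n.
have z0 : 0 <= r%:R :> R by [].
have x0 : 0 <= a%:R * r%:R * (3 / 4) ^+ K :> R.
  by rewrite ?mulr_ge0 ?exprn_ge0 ?divr_ge0.
have D0 := D_ge0; rewrite /bound natrD natrM.
move: x0 z0 e1; set x := _ * _ * _; set y := _ ^+ q; set z := r%:R => x0 z0 e1.
have e3 : D <= D * y by rewrite ler_peMr.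
have e2 : 0 <= z * (D * y) by rewrite !mulr_ge0 //; lra.
lra.
Qed.

(* [r] inputs and [q] queries are left; a query or input that still awaits its
   reply is no longer counted in them, whence the successors. *)
Definition state_bound (e : Event) (a r q : nat) : R :=
  match e with
  | EQuery => bound a r q.+1
  | ESubmit => bound a r.+1 q
  | _ => bound a r q
  end.

(** Positive probability of the history makes the query budget and the admissibility of the current
    sequence available. *)
Definition reachable (A : {set W p}) past :=
  forall ws, ws \in A -> Wstar ws /\ 0 < run ws past.

Lemma sum_found_stop M past (A : {set W p}) t a r q :
  last start past = EStop t ->
  \sum_(ws in A) mean ws (found ws) M past <= bound a r q.
Proof.
move=> pE; apply: le_trans (bound_ge_stop a r q).
have := sum_hit_le A t; rewrite size_tuple; apply: le_trans.
apply: ler_sum => ws _; case: M => [|M] /=; first by rewrite ler0n.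
rewrite [X in _ + X]big1 ?addr0; last first.
  by move=> e _; rewrite (step_stop _ _ _ _ pE) mul0r.
rewrite complete_last pE mul1r /found.
have -> : final_output past = t.
  by case/lastP: past pE => // h e; rewrite /final_output !last_rcons => ->.
by rewrite ler_nat; case: (num_actions past <= T)%N => /=.
Qed.

(** The classes partition the candidates, so the first term of [bound] adds up exactly, while the
    second is paid [p + 1] times. *)
Lemma sum_card_bound (A : {set W p}) (f : W p -> option 'I_p) r q :
  \sum_a bound #|[set ws in A | f ws == a]| r q = bound #|A| r q.+1.
Proof.
rewrite /bound big_split /=; congr (_ + _).
  rewrite -!mulr_suml; congr (_ * _ * _); rewrite -natr_sum; congr (_%:R).
  rewrite -sum1_card (partition_big f xpredT) //=.
  by apply: eq_bigr => a _; rewrite sum1dep_card; apply: eq_card => ws; rewrite !inE.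
by rewrite sumr_const card_option card_ord -[LHS]mulr_natr exprSr !mulrA.
Qed.

(* The oracle's answer splits [A] into [p + 1] classes, each of which is
   then treated separately: this is the price of one query. *)
Lemma sum_found_query M past (A : {set W p}) r q :
    (forall A' : {set W p}, forall a, reachable A' (rcons past (EAnswer a)) ->
      \sum_(ws in A') mean ws (found ws) M (rcons past (EAnswer a))
        <= bound #|A'| r q) ->
  last start past = EQuery p -> reachable A past ->
  \sum_(ws in A) mean ws (found ws) M.+1 past <= bound #|A| r q.+1.
Proof.
move=> IHM pE reach /=; set w := last (w0 p) (cur_prefix past).
rewrite (partition_big (oracle w) xpredT) //= -(sum_card_bound _ (oracle w)).
apply: ler_sum => a _.
have reach' : reachable [set ws in A | oracle w ws == a] (rcons past (EAnswer a)).
  move=> ws; rewrite inE => /andP[/reach[wsW run0] /eqP wsE]; split=> //.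
  by rewrite run_rcons_gt0 // run0 step_query // -/w wsE eqxx ltr01.
apply: le_trans (IHM _ a reach').
rewrite [leRHS](eq_bigl (fun ws => (ws \in A) && (oracle w ws == a))); last first.
  by move=> ws; rewrite inE.
apply: ler_sum => ws /andP[_ /eqP wsE].
by rewrite sum_step_query // complete_last pE mul0r add0r -/w wsE.
Qed.

Lemma submit_prob_true_le ws s : circ s -> ~~ Defs.close (last (w0 p) s) ws ->
  submit_prob R K ws s true <= (3 / 4) ^+ K.
Proof.
move=> cs /negbTE ncl; rewrite /submit_prob ncl /=.
case: eqP => [<-|_]; first exact: fval_circ.
by rewrite exprn_ge0 ?divr_ge0.
Qed.

Lemma sum_found_submit M past (A : {set W p}) r q :
    (forall A' : {set W p}, reachable A' (rcons past start) ->
      \sum_(ws in A') mean ws (found ws) M (rcons past start) <= bound #|A'| r q) ->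
  last start past = ESubmit p -> reachable A past ->
  \sum_(ws in A) mean ws (found ws) M.+1 past <= bound #|A| r.+1 q.
Proof.
move=> IHM pE reach; have [->|[ws1 ws1A]] := set_0Vmem A.
  by rewrite big_set0 bound_ge0.
pose s := cur_prefix past.
have cs : circ s by case: (reach _ ws1A) => _; exact: circ_cur_prefix.
pose uv := [:: last (w0 p) (take (size s).-1 s); last (w0 p) s].
pose A' := [set ws in A | ~~ hit ws uv].
(* As this is below 1, Z = 0 keeps positive probability, so the unhit candidates stay reachable. *)
have epsK : (3 / 4) ^+ K <= 3 / 4 :> R.
  by case: (K) K_gt0 => // k _; rewrite exprS ler_piMr ?exprn_ile1 //; lra.
have reach' : reachable A' (rcons past start).
  move=> ws; rewrite inE => /andP[/reach[wsW run0]].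
  rewrite /hit /= orbF negb_or => /andP[/negbTE nu nv]; split=> //.
  rewrite run_rcons_gt0 // run0 step_submit //= -/s nu (negbTE nv) eqxx mul1r.
  have := submit_prob_true_le cs nv; have := submit_probD R K ws s.
  have := submit_prob_ge0 R K ws s true.
  case: (_ == _) => /=; nra.
have le_ws ws : ws \in A -> mean ws (found ws) M.+1 past <=
    (hit ws uv)%:R + (3 / 4) ^+ K
    + (if ws \in A' then mean ws (found ws) M (rcons past start) else 0).
  move=> wsA; have eps0 : 0 <= (3 / 4) ^+ K :> R by rewrite exprn_ge0 ?divr_ge0.
  rewrite inE wsA andTb; have [h|nh] := boolP (hit ws uv).
    by rewrite addr0 (le_trans (stop_mean_le1 _ _ _ _ (found_le1 ws))) // lerDl.
  rewrite /= complete_last pE mul0r !add0r sum_step_submit // -/s.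
  move: nh; rewrite /hit /= orbF negb_or => /andP[/negbTE -> nv].
  rewrite (negbTE nv); have := submit_prob_true_le cs nv.
  have := submit_probD R K ws s.
  have := submit_prob_ge0 R K ws s true; have := submit_prob_ge0 R K ws s false.
  have := stop_mean_le1 pi_valid ws M (rcons past (EObs p false false true)) (found_le1 ws).
  have := stop_mean_ge0 pi_valid ws M (rcons past start) (found_ge0 ws).
  move: (mean _ _ _ _) (mean _ _ _ _) (submit_prob _ _ _ _ _) (submit_prob _ _ _ _ _).
  move=> x y z t y0 x1 z0 t0 tz tK; nra.
apply: le_trans (ler_sum _ le_ws) _; rewrite !big_split /= sumr_const -big_mkcondr /= [X in _ + X <= _](eq_bigl (mem A')); last first.
  by move=> ws; rewrite /= !inE; case: (ws \in A).
have : _ <= 2 * D := sum_hit_le A uv; have := IHM _ reach'.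
have le_card : (#|A'|%:R : R) <= #|A|%:R.
  by rewrite ler_nat; apply/subset_leq_card/fintype.subsetP => ws; rewrite inE => /andP[].
have e1 : 1 <= p.+1%:R ^+ q :> R by rewrite exprn_ege1 // ler1n.
have D0 := D_ge0; have eps0 : 0 <= (3 / 4) ^+ K :> R by rewrite exprn_ge0 ?divr_ge0.
have e8 n : (2 * n + 8)%:R = 2 * n%:R + 8 :> R by rewrite natrD natrM.
rewrite /bound !e8 -(natr1 r) -[_ *+ #|A|]mulr_natl.
move: (\sum_(i in mem A') _) (\sum_(i in A) _ : R) => S S2.
have : 0 <= r%:R :> R by [].
move: le_card e1 eps0.
move: (#|A'|%:R : R) (#|A|%:R : R) (p.+1%:R ^+ q : R) ((3 / 4) ^+ K : R) (r%:R : R).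
move=> a' a y eps z aa y1 eps0 z0 leS le2.
have : a' * z * eps <= a * z * eps by rewrite !ler_wpM2r.
have : D <= D * y by rewrite ler_peMr.
lra.
Qed.

(** Induction on the horizon [M]; the extra successor in the condition on [T] is the stopping
    round. *)
Lemma sum_found_le M past (A : {set W p}) r q :
  reachable A past ->
  (T <= (count_mem (ESubmit p) past + r).+1)%N -> (m <= num_queries past + q)%N ->
  \sum_(ws in A) mean ws (found ws) M past <= state_bound (last start past) #|A| r q.
Proof.
elim: M past A r q => [|M IHM] past A r q reach ler leq.
  by rewrite big1 //; case: last => *; apply: bound_ge0.
have [pt|] := boolP (planner_turn (last start past)); last first.
  case pE: (last start past) => [t|?||?||? ? ?] // _.
  - exact: sum_found_stop pE.
  - apply: sum_found_query => // A' a reach'.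
    have := IHM _ A' r q reach'; rewrite last_rcons; apply.
      by rewrite submits_rcons addn0.
    by rewrite queries_rcons addn0.
  - apply: sum_found_submit => // A' reach'.
    have := IHM _ A' r q reach'; rewrite last_rcons; apply.
      by rewrite submits_rcons addn0.
    by rewrite queries_rcons addn0.
have -> : state_bound (last start past) #|A| r q = bound #|A| r q.
  by case: last pt.
have [pi0 [pi1 leg]] := pi_valid past.
rewrite /= (eq_bigr (fun ws => \sum_e pi past e * mean ws (found ws) M (rcons past e))).
  2: { move=> ws _; rewrite complete_last [is_stop _](_ : _ = false) ?mul0r ?add0r.
         by apply: eq_bigr => e _; rewrite step_planner.
       by case: last pt. }
(* The planner sees only the history, so its choice has the same law for all candidates and the sums
   may be exchanged; the bound need only hold for each event. *)
rewrite exchange_big /= -[leRHS]mul1r -pi1 mulr_suml.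
apply: ler_sum => e _; rewrite -mulr_sumr.
have := pi0 e; rewrite le0r => /orP[/eqP->|e0]; first by rewrite !mul0r.
rewrite ler_pM2l //.
have reach' : reachable A (rcons past e).
  move=> ws /reach[wsW run0]; split=> //.
  by rewrite run_rcons_gt0 // run0 step_planner.
have IH r' q' := IHM (rcons past e) A r' q' reach'.
move: (leg _ e0) IH reach'; rewrite last_rcons submits_rcons queries_rcons.
case: e e0 => [t|w||a||? ? ?] //= _ _ IH reach'.
- by apply: IH; rewrite ?addn0.
- by apply: IH; rewrite ?addn0.
(* With the budget spent, a query of positive probability would contradict [query_le], unless no
   candidate is left. *)
- case: q leq IH => [|q] leq IH.
    have [->|[ws wsA]] := set_0Vmem A; first by rewrite big_set0 bound_ge0.
    have [wsW run0] := reach' _ wsA; have := query_le wsW run0.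
    by rewrite queries_rcons; lia.
  by apply: IH; rewrite ?addn0 // ?addn1 addSnnS.
(* With no input left, this one makes [T] inputs, and the run comes too late to count. *)
- case: r ler IH => [|r] ler IH.
    rewrite big1 ?bound_ge0 // => ws _; rewrite stop_mean_late //.
    by rewrite submits_rcons; lia.
  by apply: IH; rewrite ?addn0 // ?addn1 addSnnS.
Qed.

End Potential.

(** * Numerical estimates and partial sums of series *)

Section Numerics.
Variable R : realType.

Lemma bernoulli_ge1 (z : R) n : 1 <= z -> 1 + n%:R * (z - 1) <= z ^+ n.
Proof.
move=> z1; elim: n => [|n IHn]; first by rewrite mul0r addr0 expr0.
rewrite exprS -natr1; have : 0 <= n%:R :> R by [].
move: IHn; move: (z ^+ n) (n%:R : R) => y x le_y x0.
have := mulr_ge0 x0 (sqr_ge0 (z - 1)).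
have : z * (1 + x * (z - 1)) <= z * y by rewrite ler_wpM2l //; lra.
by rewrite expr2; lra.
Qed.

(** Bernoulli's inequality for [z = expR (x / n)], whose [n]-th power is [expR x]. *)
Lemma expR_div_le (x : R) n : 0 <= x -> (0 < n)%N ->
  expR (x / n%:R) <= 1 + (expR x - 1) / n%:R.
Proof.
move=> x0 n0; have n0' : 0 < n%:R :> R by rewrite ltr0n.
rewrite -lerBlDl ler_pdivlMr // mulrC -(lerD2l 1) subrKC.
rewrite -[in leRHS](divfK (lt0r_neq0 n0') x) expRM_natr.
by apply: bernoulli_ge1; rewrite -expR0 ler_expR divr_ge0.
Qed.

(** The left side is the 1000th root of [(21 / 20) ^+ k]; the summand 1 on the right is what covers
    small [k]. *)
Lemma pow_two_le k :
  2 `^ (ln (21 / 20) / (1000 * ln 2) * k%:R) <= 1 + (21 / 20) ^+ k / 1000 :> R.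
Proof.
have l2 : 0 < ln 2 :> R by rewrite ln_gt0 // ltr1n.
have lb : 0 <= ln (21 / 20) :> R by rewrite ln_ge0 //; lra.
rewrite /powR pnatr_eq0 /=.
have -> : ln (21 / 20) / (1000 * ln 2) * k%:R * ln 2 =
          k%:R * ln (21 / 20) / 1000 :> R by field; rewrite lt0r_neq0.
apply: le_trans (expR_div_le _ _) _ => //; first by rewrite mulr_ge0.
rewrite expRM_natl lnK ?posrE; last lra.
by rewrite lerD2l ler_pM2r ?invr_gt0 ?ltr0n // gerBl.
Qed.

(* [ln (p+1) <= 2 ln p], so [m] answers carry at most [p / 50] nats. *)
Lemma answers_le p n m : p = (4 * n)%N -> (1 < p)%N ->
  m%:R <= 1 / 100 * p%:R / ln p%:R :> R -> p.+1%:R ^+ m <= (11 / 10) ^+ n :> R.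
Proof.
move=> pE p1; have lp : 0 < ln p%:R :> R by rewrite ln_gt0 // ltr1n.
rewrite ler_pdivlMr // => le_m.
have lp1 : ln p.+1%:R <= 2 * ln p%:R :> R.
  rewrite mulr_natl -lnXn ?ltr0n ?(ltnW p1) // ler_ln ?posrE ?ltr0n //.
    by rewrite -natrX ler_nat; nia.
  by rewrite exprn_gt0 // ltr0n ltnW.
rewrite -[p.+1%:R]lnK ?posrE ?ltr0n // -expRM_natl.
(* The exponent is p/50 = 2n/25; the bound follows from exp(-2/25) >= 23/25 > 10/11. *)
have e8 : expR (2 / 25) <= 11 / 10 :> R.
  have := expR_ge1Dx (- (2 / 25) : R); rewrite expRN => le1.
  have x0 := expR_gt0 (2 / 25 : R).
  by rewrite -ler_pV2 ?inE ?unitfE ?gt_eqF //; lra.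
apply: (@le_trans _ _ (expR (n%:R * (2 / 25)))).
  rewrite ler_expR (le_trans (ler_wpM2l _ lp1)) //.
  by move: le_m; rewrite pE natrM; lra.
by rewrite expRM_natl lerXn2r ?nnegrE ?expR_ge0 //; lra.
Qed.

Lemma bound_small p n K m r (a : R) : p = (4 * n)%N -> (40 <= n)%N ->
  r%:R <= (21 / 20) ^+ minn p K / 100 :> R -> p.+1%:R ^+ m <= (11 / 10) ^+ n :> R ->
  2 ^+ p / 2 <= a ->
  a * r%:R * (3 / 4) ^+ K + (2 * r + 8)%:R * (2 ^+ p * (16 / 27) ^+ n) * p.+1%:R ^+ m
    <= a * (1 / 50).
Proof.
move=> pE n40; set k := minn p K => le_r le_m le_a.
have N0 : 0 < 2 ^+ p :> R by rewrite exprn_gt0.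
(* The growth of [r] is beaten because (21/20)(3/4) < 1. *)
have e1 : r%:R * (3 / 4) ^+ K <= 1 / 100 :> R.
  have le_K : (3 / 4) ^+ K <= (3 / 4) ^+ k :> R.
    by rewrite ler_wiXn2l ?geq_minr //; lra.
  apply: le_trans (_ : (21 / 20) ^+ k / 100 * (3 / 4) ^+ k <= _).
    by rewrite ler_pM ?exprn_ge0 ?divr_ge0.
  rewrite mulrAC -exprMn ler_pdivrMr // [leRHS](_ : _ = 1); last by field.
  by apply: exprn_ile1; lra.
have e2 : (2 * r + 8)%:R <= 9 * (21 / 20) ^+ p :> R.
  have : (21 / 20) ^+ k <= (21 / 20) ^+ p :> R.
    by rewrite ler_weXn2l ?geq_minl //; lra.
  have : 1 <= (21 / 20) ^+ p :> R by rewrite exprn_ege1 //; lra.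
  by rewrite natrD natrM; move: le_r; lra.
(* Four coordinates at a time: (21/20)^4 (16/27) (11/10) < 4/5. *)
have e3 : (2 * r + 8)%:R * (16 / 27) ^+ n * p.+1%:R ^+ m <= 9 * (4 / 5) ^+ n :> R.
  apply: le_trans (_ : 9 * (21 / 20) ^+ p * (16 / 27) ^+ n * (11 / 10) ^+ n <= _).
    rewrite ler_pM ?mulr_ge0 ?exprn_ge0 ?divr_ge0 //.
    by rewrite ler_wpM2r ?exprn_ge0 ?divr_ge0.
  rewrite pE exprM -!mulrA -!exprMn ler_pM2l //.
  by apply: lerXn2r; rewrite ?nnegrE; lra.
(* Since (4/5)^10 <= 1/8 and 8^4 = 4096, [n >= 40] suffices. *)
have e4 : (4 / 5) ^+ n <= 1 / 4000 :> R.
  apply: le_trans (_ : (4 / 5) ^+ (10 * 4) <= _); first by rewrite ler_wiXn2l //; lra.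
  rewrite exprM; apply: le_trans (_ : (1 / 8) ^+ 4 <= _); last by lra.
  by rewrite lerXn2r ?nnegrE ?exprn_ge0 ?divr_ge0 //; lra.
set E := (3 / 4) ^+ K in e1 *; set C := (2 * r + 8)%:R in e3 *.
set y := (16 / 27) ^+ n in e3 *; set P := p.+1%:R ^+ m in e3 *.
have -> : a * r%:R * E + C * (2 ^+ p * y) * P =
          a * (r%:R * E) + 2 ^+ p * (C * y * P) by ring.
have : a * (r%:R * E) <= a * (1 / 100) by rewrite ler_wpM2l //; lra.
have : 2 ^+ p * (C * y * P) <= 2 ^+ p * (9 / 4000) by rewrite ler_wpM2l //; lra.
lra.
Qed.

Lemma nneseries_le (u : nat -> R) x : (forall n, 0 <= u n) ->
  (forall M, \sum_(0 <= n < M) u n <= x) ->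
  (\sum_(0 <= n <oo) (u n)%:E <= x%:E)%E.
Proof.
move=> u0 le_x; apply: lime_le; first by apply: is_cvg_nneseries => *; rewrite lee_fin.
by apply: nearW => M; rewrite sumEFin lee_fin.
Qed.

(** The bound persists for all larger horizons, so that finitely many series can share one. *)
Lemma nneseries_gt (u : nat -> R) x : (forall n, 0 <= u n) ->
  (x%:E < \sum_(0 <= n <oo) (u n)%:E)%E ->
  exists M0, forall M, (M0 <= M)%N -> x < \sum_(0 <= n < M) u n.
Proof.
move=> u0 lt_x; have [M0 ltM0] : exists M, x < \sum_(0 <= n < M) u n.
  apply: contrapT => nex; move: lt_x; apply/negP; rewrite -leNgt.
  apply: nneseries_le => // M; rewrite leNgt; apply/negP => ltM.
  by apply: nex; exists M.
exists M0 => M leM; apply: lt_le_trans ltM0 _.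
by rewrite (big_cat_nat _ leM) //= lerDl sumr_ge0.
Qed.

End Numerics.

(** * From soundness to a slow hidden vector *)

Section LowerBound.
Variables (p : nat) (R : realType) (K : nat) (pi : planner p R).
Hypothesis pi_valid : valid_planner K pi.

Local Notation mean := (stop_mean K pi).

Definition within (t : nat) (h : seq (Event p)) : R := (num_actions h <= t)%N%:R.

Lemma sum_run_within ws t n :
  \sum_(h : n.-tuple (Event p) | complete h && (num_actions h <= t)%N)
    run_prob K pi ws h =
  \sum_(h : n.-tuple (Event p) | complete h) run_prob K pi ws h * within t h.
Proof.
rewrite big_mkcondr; apply: eq_bigr => h _; rewrite /within.
by case: leq; rewrite ?mulr1 ?mulr0.
Qed.

Lemma run_within_ge0 ws t n :
  0 <= \sum_(h : n.-tuple (Event p) | complete h) run_prob K pi ws h * within t h.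
Proof. by apply: sumr_ge0 => h _; rewrite mulr_ge0 // run_from_ge0. Qed.

Lemma prob_N_leE ws t : prob_N_le K pi ws t = (\sum_(0 <= n <oo)
  (\sum_(h : n.-tuple (Event p) | complete h) run_prob K pi ws h * within t h)%:E)%E.
Proof. by apply: eq_eseriesr => n _; rewrite sum_run_within. Qed.

Lemma prob_N_le_ge0 ws t : (0 <= prob_N_le K pi ws t)%E.
Proof.
by rewrite prob_N_leE; apply: nneseries_ge0 => n _ _; rewrite lee_fin run_within_ge0.
Qed.

Lemma prob_N_le_le1 ws t : (prob_N_le K pi ws t <= 1)%E.
Proof.
rewrite prob_N_leE; apply: nneseries_le => [n|M]; first exact: run_within_ge0.
have := stop_mean_le1 pi_valid ws (F := within t) M [::]; rewrite stop_meanE; apply.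
by move=> h; rewrite lern1 leq_b1.
Qed.

Lemma prob_N_le0 ws : prob_N_le K pi ws 0 = 0%E.
Proof.
rewrite prob_N_leE; apply: eseries0 => n _ _; rewrite big1 // => h _.
by rewrite /within mulr0.
Qed.

Lemma prob_N_le_homo ws t t' : (t <= t')%N ->
  (prob_N_le K pi ws t <= prob_N_le K pi ws t')%E.
Proof.
move=> le_t; rewrite !prob_N_leE; apply: lee_nneseries => n _.
  by move=> _; rewrite lee_fin run_within_ge0.
rewrite lee_fin; apply: ler_sum => h _; rewrite ler_wpM2l ?run_from_ge0 //.
by rewrite /within ler_nat; case: leqP => // /leq_trans-> .
Qed.

(** The term [t = 0] is 1, as every run has at least one action; the terms from 1 to [T] are at
    least 1/10 by monotonicity. *)
Lemma expected_N_ge ws T : (prob_N_le K pi ws T <= (9 / 10)%:E)%E ->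
  ((1 + T%:R / 10)%:E <= expected_N K pi ws)%E.
Proof.
move=> leT; rewrite /expected_N.
apply: le_trans (nneseries_lim_ge T.+1 _); last first.
  by move=> t _ _; rewrite sube_ge0 ?prob_N_le_le1 ?orbT.
rewrite big_nat_recl // prob_N_le0 sube0 EFinD leeD2l //.
apply: (@le_trans _ _ (\sum_(0 <= t < T) (1 / 10)%:E)%E).
  by rewrite sumEFin lee_fin sumr_const_nat subn0 -[leRHS]mulr_natl div1r.
rewrite [leLHS]big_nat [leRHS]big_nat; apply: lee_sum => t /andP[_ ltT].
have := le_trans (prob_N_le_homo ws ltT) leT; have := prob_N_le_ge0 ws t.+1.
case: (prob_N_le _ _ _ _) => [x| |] //=; rewrite !lee_fin => _ ?; lra.
Qed.

(** If the planner were fast for every [ws], each would have success probability at least 1/40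
    within [r.+1] actions, against an average of at most 1/50. *)
Lemma exists_slow (n m r : nat) :
  p = (4 * n)%N -> (40 <= n)%N -> (0 < K)%N -> sound K pi ->
  (forall ws, Wstar ws -> forall h, 0 < run_prob K pi ws h -> (num_queries h <= m)%N) ->
  r%:R <= (21 / 20) ^+ minn p K / 100 :> R -> p.+1%:R ^+ m <= (11 / 10) ^+ n :> R ->
  exists2 ws, Wstar ws & (prob_N_le K pi ws r.+1 <= (9 / 10)%:E)%E.
Proof.
move=> pE n40 K0 snd qle le_r le_m; apply: contrapT => nex.
have p0 : (0 < p)%N by lia.
pose rew ws h := reward R ws (final_output (p := p) h).
have lim ws : exists M0, Wstar ws -> forall M, (M0 <= M)%N ->
    23 / 100 < mean ws (rew ws) M [::] /\ 9 / 10 < mean ws (within r.+1) M [::].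
  have [wsW|] := boolP (Wstar ws); last by exists 0%N.
  have [Ma leMa] : exists M0, forall M, (M0 <= M)%N -> 23 / 100 < mean ws (rew ws) M [::].
    under eq_exists do under eq_forall do rewrite stop_meanE.
    apply: nneseries_gt => [k|].
      by apply: sumr_ge0 => h _; rewrite mulr_ge0 ?run_from_ge0 ?reward_ge0.
    have /andP[+ _] := snd ws wsW; apply: lt_le_trans; rewrite lte_fin.
    by have := max_reward_ge R p0 wsW; lra.
  have [Mb leMb] : exists M0, forall M, (M0 <= M)%N -> 9 / 10 < mean ws (within r.+1) M [::].
    under eq_exists do under eq_forall do rewrite stop_meanE.
    apply: nneseries_gt => [k|]; first exact: run_within_ge0.
    rewrite -prob_N_leE ltNge; apply/negP => le9; apply: nex; by exists ws.
  exists (maxn Ma Mb) => _ M; rewrite geq_max => /andP[/leMa ? /leMb ?]; by split.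
(* One horizon serves all of the finitely many [ws]. *)
have [f fP] := choice lim; pose M := \max_ws f ws.
pose A := [set ws : W p | Wstar ws].
have le_ws ws : ws \in A -> 1 / 40 <= mean ws (found R r.+1 ws) M [::].
  rewrite inE => wsW; have [] := fP ws wsW M (leq_bigmax _).
  (* A hit is either found in time or belongs to a late run. Taking means, success exceeds 23/100 +
     9/10 - 1 - (3/4)^8, which is above 1/40. *)
  have := @ler_stop_mean _ _ _ _ pi_valid ws (rew ws)
    (fun h => (1 + (3 / 4) ^+ 8) * 1 + ((-1) * within r.+1 h + found R r.+1 ws h)) M.
  rewrite !stop_mean_lin.
  have := stop_mean_le1 pi_valid ws (F := fun=> 1) M [::] (fun=> lexx _).
  move=> le1 le2 gt1 gt2.
  suff /le2 : forall h, complete h -> 0 < run_prob K pi ws h -> rew ws h <=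
    (1 + (3 / 4) ^+ 8) * 1 + ((-1) * within r.+1 h + found R r.+1 ws h) by lra.
  move=> h ch h0; have [t tE ct] := circ_final_output pi_valid h0 ch.
  rewrite /rew /within /found tE; have := reward_le_hit R ws p0 ct.
  by case: leq; case: hit => /=; lra.
have cA := card_Wstar R pE (leq_trans (isT : (3 <= 40)%N) n40).
have := @sum_found_le p R K pi pi_valid p0 K0 m r.+1 _ qle
  (fun w => card_nearby R w pE) M [::] A r m.
have reachA : reachable K pi A [::] by move=> ws; rewrite inE; split.
move=> /(_ reachA); rewrite add0n => /(_ (leqnn _) (leqnn _)) /=.
have le_sum : #|A|%:R * (1 / 40) <= \sum_(ws in A) mean ws (found R r.+1 ws) M [::].
  by rewrite mulr_natl -sumr_const; apply: ler_sum.
move=> /(le_trans le_sum) /le_trans /(_ (bound_small pE n40 le_r le_m cA)).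
have : 0 < 2 ^+ p / 2 :> R by rewrite divr_gt0 ?exprn_gt0.
by move: cA; rewrite -/A; lra.
Qed.

End LowerBound.

(** * Choice of the constants *)

Theorem theorem6 (R : realType) :
  exists c1 c2 : R, 0 < c1 /\ 0 < c2 /\
  exists p0 : nat, forall p K : nat,
    (p0 <= p)%N -> (4 %| p)%N -> (1 <= K)%N ->
    forall pi : planner p R,
      valid_planner K pi -> sound K pi ->
      query_bounded K pi (c1 * p%:R / ln p%:R) ->
      exists ws : W p, Wstar ws /\
        ((2 `^ (c2 * (minn p K)%:R))%:E <= expected_N K pi ws)%E.
Proof.
exists (1 / 100), (ln (21 / 20) / (1000 * ln 2)); split; first lra.
have l2 : 0 < ln 2 :> R by rewrite ln_gt0 // ltr1n.
have lb : 0 < ln (21 / 20) :> R by rewrite ln_gt0; lra.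
split; first by apply: divr_gt0 lb _; apply: mulr_gt0 l2; rewrite ltr0n.
exists 160%N => p K p160 /dvdnP[n]; rewrite mulnC => pE K0 pi pi_valid snd qb.
set Q := (_ / ln p%:R) in qb; pose m := Num.truncn Q.
have p1 : (1 < p)%N by lia.
have Q0 : 0 <= Q by rewrite !mulr_ge0 // ?invr_ge0 ?ln_ge0 ?ler1n //; lia.
have qle ws : Wstar ws -> forall h, 0 < run_prob K pi ws h -> (num_queries h <= m)%N.
  by move=> wsW h h0; rewrite /m truncn_ge_nat // ltW // (qb ws).
have le_m : p.+1%:R ^+ m <= (11 / 10) ^+ n :> R.
  by apply: (answers_le pE) => //; rewrite -/Q truncn_le.
(* Rounding down gives [r <= B / 100 < r + 1]: the left half feeds the union bound, the right half
   turns [r.+1] actions into [B / 1000]. *)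
pose B : R := (21 / 20) ^+ minn p K; pose r := Num.truncn (B / 100).
have B0 : 0 <= B / 100 by rewrite divr_ge0 // exprn_ge0 // divr_ge0.
have /andP[r_le r_gt] := truncn_itv B0.
have n40 : (40 <= n)%N by lia.
have [ws wsW le9] := exists_slow pi_valid pE n40 K0 snd qle r_le le_m.
exists ws; split=> //; apply: le_trans (expected_N_ge pi_valid le9).
rewrite lee_fin (le_trans (pow_two_le _ _)) // -/B lerD2l.
have -> : 1000 = 100 * 10 :> R by rewrite -natrM.
by rewrite invfM mulrA ler_pM2r ?invr_gt0 ?ltr0n // ltW.
Qed.
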